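(* Let $W = DK/(2\pi)$ be the maximum translation in wavelengths, and let $\epsilon>0$ be the desired precision. Let $H$ be the number of singular values $\Sigma_\zeta$ of the translation kernel $F(\boldsymbol{\delta},\boldsymbol{k})$ larger than $\epsilon$, i.e. $H$ is the $\epsilon$-rank of $F$. Then $$H = O\bigl((W+\log(1/\epsilon))^2\bigr).$$
   Context: For $R>0$, $\Omega_R:=\{\boldsymbol{x}\in\mathbb{R}^2:\|\boldsymbol{x}\|\le R\}$. Here $K>0$ is the maximum spatial frequency and $D>0$ the maximum translation magnitude considered, so that $W=DK/(2\pi)$ is the maximum translation magnitude in units of the wavelength $2\pi/K$ at the largest frequency $K$. The translation kernel is $F(\boldsymbol{\delta},\boldsymbol{k})=e^{-\mathrm{i}\boldsymbol{\delta}\cdot\boldsymbol{k}}$ for $\boldsymbol{\delta}\in\Omega_D$, $\boldsymbol{k}\in\Omega_K$. In polar coordinates $\boldsymbol{\delta}=(\delta\cos\omega,\delta\sin\omega)$, $\boldsymbol{k}=(k\cos\psi,k\sin\psi)$, it has the Jacobi--Anger expansion $$F(\boldsymbol{\delta},\boldsymbol{k})=e^{-\mathrm{i}\delta k\cos(\psi-\omega)}=\sum_{\ell\in\mathbb{Z}}J_\ell(\delta k)\,e^{\mathrm{i}\ell(\psi-\omega-\pi/2)},$$ where $J_\ell$ is the Bessel function of the first kind of integer order $\ell$. For each $\ell\in\mathbb{Z}$, the operator singular value decomposition of the kernel $J_\ell(\delta k)$ is $$J_\ell(\delta k)=\sum_{\eta=1}^\infty U_\eta(\delta;\ell)\,\Sigma_\eta(\ell)\,V_\eta(k;\ell),\qquad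 \delta\in[0,D],\ k\in[0,K],$$ where $\Sigma_1(\ell)\ge\Sigma_2(\ell)\ge\dots\to 0$ are the singular values, $\{U_\eta(\cdot;\ell)\}_{\eta\ge1}$ are orthonormal on $[0,D]$ with respect to $\delta\,d\delta$, and $\{V_\eta(\cdot;\ell)\}_{\eta\ge1}$ are orthonormal on $[0,K]$ with respect to $k\,dk$. The singular values $\Sigma_1\ge\Sigma_2\ge\cdots$ of the translation kernel $F$ are the whole family $\{\Sigma_\eta(\ell):\ell\in\mathbb{Z},\ \eta\ge1\}$ relabeled by a single index $\zeta=1,2,\dots$ in non-increasing order, counted with multiplicity. Thus $H=\sum_{\ell\in\mathbb{Z}}H_\ell$, where $H_\ell$ is the number of singular values $\Sigma_\eta(\ell)$ greater than $\epsilon$. *)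

(* Defs.v *)
From mathcomp Require Import all_boot all_order all_algebra.
From mathcomp Require Import all_classical all_reals all_analysis.

Set Implicit Arguments.
Unset Strict Implicit.
Unset Printing Implicit Defensive.

Import Order.TTheory GRing.Theory Num.Theory.
Import numFieldTopology.Exports numFieldNormedType.Exports.

Local Open Scope classical_set_scope.
Local Open Scope ring_scope.

Definition besselJ_coeff {R : realType} (n : nat) (x : R) (m : nat) : R :=
  (-1) ^+ m / (m`! * (m + n)`!)%N%:R * (x / 2) ^+ (m.*2 + n).

(* Bessel function of the first kind of integer order, from its power series;
   negative orders through J_{-n} = (-1)^n J_n, which is what the series gives
   when 1 / (m - n)! is read as 1 / Gamma (m - n + 1) = 0 for m < n. *)
Definition besselJ {R : realType} (l : int) (x : R) : R :=
  match l with
  | Posz n => limn (series (besselJ_coeff n x))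
  | Negz n => (-1) ^+ n.+1 * limn (series (besselJ_coeff n.+1 x))
  end.

(* Orthonormality in L^2([0, a], r dr). *)
Definition radial_orthonormal {R : realType} (a : R) (f : nat -> R -> R) :=
  (forall i, measurable_fun `[0, a] (f i)) /\
  forall i j,
    (\int[lebesgue_measure]_(r in `[0%R, a]) (f i r * f j r * r)%:E)%E
      = ((i == j)%:R)%:E :> \bar R.

(* Singular value decomposition of the kernel g on [0, D] x [0, K], with respect
   to the measures x dx and k dk. The index i : nat stands for eta = i + 1, and
   the expansion of g converges in L^2(x dx k dk). *)
Definition radial_svd {R : realType} (D K : R) (g : R -> R -> R)
    (U : nat -> R -> R) (S : nat -> R) (V : nat -> R -> R) :=
  [/\ radial_orthonormal D U,
      radial_orthonormal K V,
      nonincreasing_seq S,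
      S @ \oo --> 0 &
      (fun n => \int[lebesgue_measure]_(x in `[0%R, D])
                \int[lebesgue_measure]_(k in `[0%R, K])
                  ((g x k - \sum_(i < n) U i x * S i * V i k) ^+ 2
                     * k * x)%:E)%E @ \oo --> (0 : \bar R)%E].

(* The singular values of F(d, k) = exp (- i d . k) on Omega_D x Omega_K. By the
   Jacobi-Anger expansion
     F(d, k) = \sum_(l in Z) J_l(|d| |k|) exp (i l (psi - omega - pi / 2)),
   with omega and psi the polar angles of d and k, F splits into the radial
   kernels J_l(x k); sigma lists their singular values over all orders l in
   nonincreasing order, with multiplicity. A bijective listing exists because no
   S l i vanishes: each of these kernels has infinite rank. *)
Definition translation_singular_values {R : realType} (D K : R)
    (sigma : nat -> R) :=
  exists (U : int -> nat -> R -> R) (S : int -> nat -> R)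
         (V : int -> nat -> R -> R) (e : nat -> int * nat),
    [/\ forall l, radial_svd D K (fun x k => besselJ l (x * k)) (U l) (S l) (V l),
        bijective e,
        forall z, sigma z = S (e z).1 (e z).2 &
        nonincreasing_seq sigma].

(* The value is +oo when infinitely many terms of sigma exceed eps. *)
Definition eps_rank {R : realType} (sigma : nat -> R) (eps : R) : \bar R :=
  counting [set z | eps < sigma z].

(* Main.v *)
(* Write z = D K = 2 pi W. By the Eckart-Young inequality, S_i is at most the
   Hilbert-Schmidt distance from the kernel to any kernel of rank i. Truncating the
   power series of J_l(x k) after i terms leaves a kernel of rank i and an error
   O(exp(2 z) / 2^(2 i + |l|)), so S_i(l) > eps forces
   2 i + |l| < 2 (3 z + ln (1 / eps)), which leaves a quadratic number of pairs (l, i),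
   up to an additive constant.

   To absorb the additive constant, and to cover eps >= 1, one needs S_0(l) to be
   smaller than exp W with a uniform margin; then S_i(l) > eps implies
   W + ln (1 / eps) >= c (W + 1). With i = 0 the Eckart-Young bound is the
   Hilbert-Schmidt norm, and J_l^2 <= 1/2 for l <> 0 (Neumann's identity
   J_0^2 + 2 (J_1^2 + J_2^2 + ...) = 1) gives S_0(l)^2 <= z^2 / 8, while
   r J_0(r)^2 <= 3/4 (Sonine's monotonicity argument for the Bessel equation) gives
   S_0(0)^2 <= 3 z / 4. *)
Require Import Defs.
From mathcomp Require Import all_boot all_order all_algebra.
From mathcomp Require Import all_classical all_reals all_analysis.
From mathcomp Require Import measurable_realfun ring lra zify.
Import Order.TTheory GRing.Theory Num.Theory.
Import numFieldTopology.Exports numFieldNormedType.Exports.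
Set Implicit Arguments.
Unset Strict Implicit.
Unset Printing Implicit Defensive.

Local Open Scope classical_set_scope.
Local Open Scope ring_scope.

(** * Bessel functions *)

(** From index [M] on, the series is dominated by a geometric one of ratio 1/2 and sum 2 C. With
    [M = 0] this gives convergence, with general [M] truncation errors. *)
Lemma geometric_tail (R : realType) (u : R^nat) (M : nat) (C : R) :
  (forall m, `|u (M + m)%N| <= C / 2 ^+ m) ->
  cvgn (series u) /\ `|limn (series u) - series u M| <= 2 * C.
Proof.
move=> uC.
have C0 : 0 <= C by have := uC 0%N; rewrite expr0 divr1; exact: le_trans.
have geo k : \sum_(0 <= j < k) C / 2 ^+ j <= 2 * C.
  have -> : \sum_(0 <= j < k) C / 2 ^+ j = 2 * C - 2 * C / 2 ^+ k.
    elim: k => [|k IH]; first by rewrite big_nil expr0 divr1 subrr.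
    rewrite big_nat_recr//= IH exprS invfM.
    by have : (2 : R) ^+ k != 0 by []; move=> ?; field.
  by rewrite gerBl// divr_ge0// mulr_ge0.
have tail k : \sum_(M <= j < M + k) `|u j| <= 2 * C.
  apply: le_trans (geo k); rewrite -{1}[M]add0n big_addn addKn.
  by apply: ler_sum => j _; rewrite addnC.
have cu : cvgn (series u).
  apply: normed_cvg; apply: nondecreasing_is_cvgn.
    apply/nondecreasing_seqP => n; rewrite /series/=.
    by rewrite [leRHS]big_nat_recr//= lerDl.
  exists (\sum_(0 <= j < M) `|u j| + 2 * C) => _ [n _ <-].
  rewrite /series/=; apply: (@le_trans _ _ (\sum_(0 <= j < M + n) `|u j|)).
    by rewrite addnC /= (big_cat_nat (n := n)) ?leq_addr//= lerDl sumr_ge0.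
  by rewrite (big_cat_nat (n := M)) ?leq_addr//= lerD2l.
split=> //.
have cs : (fun n => `|series u n - series u M|) @ \oo
    --> `|limn (series u) - series u M|.
  by apply: cvg_norm; apply: cvgB => //; exact: cvg_cst.
rewrite -(cvg_lim _ cs)//; apply: limr_le; first by apply/cvg_ex; eexists; exact: cs.
exists M => // n /= Mn; rewrite /series/= (big_cat_nat (n := M))//= addrAC subrr add0r.
by rewrite (le_trans (ler_norm_sum _ _ _))// -(subnKC Mn) tail.
Qed.

Lemma expR_ge_exp_coeff (R : realType) (x : R) (n : nat) :
  0 <= x -> x ^+ n / n`!%:R <= expR x.
Proof.
move=> x0; case: n => [|n]; last by have := expR_ge1Dxn n x0; lra.
by rewrite expr0 fact0 divr1 -expR0 ler_expR.
Qed.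

(** Coefficients of the Bessel-Clifford function C_n, for which J_n(x) = (x/2)^n C_n(-(x/2)^2).
    Unlike J_n, it is a power series without gaps, to which termwise differentiation applies
    directly. *)
Definition bessel_clifford_coeff {R : realType} (n m : nat) : R :=
  ((m`! * (m + n)`!)%N%:R)^-1.

Definition bessel_clifford {R : realType} (n : nat) (y : R) : R :=
  limn (pseries (bessel_clifford_coeff n) y).

Lemma bessel_clifford_coeff_gt0 (R : realType) n m :
  0 < bessel_clifford_coeff n m :> R.
Proof. by rewrite invr_gt0 ltr0n muln_gt0 !fact_gt0. Qed.

Lemma bessel_clifford_coeffE (R : realType) n m :
  bessel_clifford_coeff n m = (m`!%:R)^-1 * ((m + n)`!%:R)^-1 :> R.
Proof. by rewrite /bessel_clifford_coeff natrM invfM. Qed.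

Lemma cvg_bessel_clifford (R : realType) n (y : R) :
  cvgn (pseries (bessel_clifford_coeff n) y).
Proof.
have [|//] := @geometric_tail R (fun i => bessel_clifford_coeff n i * y ^+ i)
  0%N (expR (2 * `|y|)) _.
move=> m; rewrite add0n normrM normrX gtr0_norm ?bessel_clifford_coeff_gt0//.
rewrite ler_pdivlMr ?exprn_gt0// bessel_clifford_coeffE.
have := @expR_ge_exp_coeff _ (2 * `|y|) m; rewrite mulr_ge0// => /(_ isT).
apply: le_trans; rewrite exprMn.
have -> : m`!%:R^-1 / (m + n)`!%:R * `|y| ^+ m * 2 ^+ m =
  (2 ^+ m * `|y| ^+ m / m`!%:R) * ((m + n)`!%:R)^-1 by ring.
by rewrite ler_piMr ?divr_ge0 ?mulr_ge0 ?exprn_ge0// invf_le1 ?ltr0n ?ler1n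
  ?fact_gt0.
Qed.

(** Since (m+1) / (m+1)! = 1 / m!, differentiation only shifts the order: C_n' = C_(n+1). *)
Lemma pseries_diffs_bessel_clifford (R : realType) n :
  pseries_diffs (bessel_clifford_coeff n) = bessel_clifford_coeff n.+1 :> R^nat.
Proof.
apply/funext => m; rewrite /pseries_diffs !bessel_clifford_coeffE factS natrM.
by rewrite addSnnS invfM !mulrA mulfV ?mul1r// pnatr_eq0.
Qed.

Lemma is_derive_bessel_clifford (R : realType) n (y : R) :
  is_derive y 1 (bessel_clifford n) (bessel_clifford n.+1 y).
Proof.
rewrite /bessel_clifford -pseries_diffs_bessel_clifford.
apply: (@pseries_snd_diffs _ _ (`|y| + 1)).
- exact: cvg_bessel_clifford.
- by rewrite pseries_diffs_bessel_clifford; exact: cvg_bessel_clifford.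
- by rewrite !pseries_diffs_bessel_clifford; exact: cvg_bessel_clifford.
- by rewrite [ltRHS]ger0_norm ?ltrDl// addr_ge0.
Qed.

(** Comparing coefficients of y^m, this is (n+1) + m = m+n+1 divided by m! (m+n+1)!. It is the
    source of the three-term recurrence for J_n. *)
Lemma bessel_cliffordS (R : realType) n (y : R) :
  bessel_clifford n y =
  n.+1%:R * bessel_clifford n.+1 y + y * bessel_clifford n.+2 y.
Proof.
have cB k := @cvg_bessel_clifford R k y.
apply/cvg_lim => //.
(* The factor y raises exponents by one, so k+1 terms of orders n and n+1 match k terms of order
   n+2, and the identity is exact on partial sums. *)
rewrite -(cvg_shiftn 1).
have -> : (fun k => pseries (bessel_clifford_coeff n) y (k + 1)%N) =
   (fun k => n.+1%:R * pseries (bessel_clifford_coeff n.+1) y (k + 1)%N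
       + y * pseries (bessel_clifford_coeff n.+2) y k).
  apply/funext => k; rewrite addn1 /pseries /series/= !mulr_sumr.
  rewrite [LHS]big_nat_recl//= [X in _ = X + _]big_nat_recl//= -addrA.
  rewrite -big_split/=; congr (_ + _).
    rewrite !expr0 !mulr1 !bessel_clifford_coeffE !add0n factS natrM invfM.
    by rewrite [RHS]mulrCA mulVKf ?pnatr_eq0.
  apply: eq_bigr => i _; rewrite !bessel_clifford_coeffE exprS.
  have e1 : (i.+1 + n.+1)`!%:R = (i.+1%:R + n.+1%:R) * (i + n.+1)`!%:R :> R.
    by rewrite -natrD -natrM.
  have -> : (i + n.+2 = i.+1 + n.+1)%N by rewrite addSnnS.
  rewrite e1 addSnnS factS natrM.
  have : i.+1%:R + n.+1%:R != 0 :> R by rewrite -natrD pnatr_eq0.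
  have : i.+1%:R != 0 :> R by rewrite pnatr_eq0.
  have : i`!%:R != 0 :> R by rewrite pnatr_eq0 -lt0n fact_gt0.
  have : (i + n.+1)`!%:R != 0 :> R by rewrite pnatr_eq0 -lt0n fact_gt0.
  move: (i.+1%:R) (n.+1%:R) (i`!%:R) ((i + n.+1)`!%:R) => a b A B *.
  by field; do ?[apply/andP; split].
apply: cvgD; apply: cvgM; (try exact: cvg_cst) => //.
by rewrite (cvg_shiftn 1).
Qed.

Definition besselN {R : realType} (n : nat) (x : R) : R :=
  (x / 2) ^+ n * bessel_clifford n (- (x / 2) ^+ 2).

(** Evaluated at a product x k, this is a sum of [i] products of a function of x and a function of
    k: the rank [i] approximant for the Eckart-Young bound. *)
Definition besselN_trunc {R : realType} (n i : nat) (x : R) : R :=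
  (x / 2) ^+ n * pseries (bessel_clifford_coeff n) (- (x / 2) ^+ 2) i.

Lemma series_besselJ_coeff (R : realType) n (x : R) :
  series (besselJ_coeff n x) = besselN_trunc n ^~ x.
Proof.
apply/funext => i; rewrite /besselN_trunc /pseries /series/= mulr_sumr.
apply: eq_bigr => m _; rewrite /besselJ_coeff /bessel_clifford_coeff.
by rewrite [in RHS]exprNn -exprM mul2n exprD; ring.
Qed.

Lemma cvg_besselN_trunc (R : realType) n (x : R) :
  besselN_trunc n i x @[i --> \oo] --> besselN n x.
Proof. by apply: cvgM; [exact: cvg_cst|exact: cvg_bessel_clifford]. Qed.

Lemma lim_besselJ_coeff (R : realType) n (x : R) :
  limn (series (besselJ_coeff n x)) = besselN n x.
Proof.
by rewrite series_besselJ_coeff; apply/cvg_lim => //; exact: cvg_besselN_trunc.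
Qed.

Definition besselJ_sign {R : realType} (l : int) : R :=
  if l is Negz n then (-1) ^+ n.+1 else 1.

Lemma besselJ_sign_sqr (R : realType) l : besselJ_sign l ^+ 2 = 1 :> R.
Proof. by case: l => n; rewrite /besselJ_sign ?expr1n// sqrr_sign. Qed.

Lemma besselJE (R : realType) (l : int) (x : R) :
  besselJ l x = besselJ_sign l * besselN `|l|%N x.
Proof. by case: l => n; rewrite /besselJ /besselJ_sign lim_besselJ_coeff ?mul1r. Qed.

(** The m-th term is, up to sign, the product of (x/2)^m / m! and (x/2)^(m+n) / (m+n)!. Each factor
    is at most exp x over the matching power of 2, so the terms are bounded by exp(2x) /
    2^(2m+n). *)
Lemma besselN_tail (R : realType) n i (x : R) : 0 <= x ->
  `|besselN n x - besselN_trunc n i x| <= 2 * (expR (2 * x) / 2 ^+ (i.*2 + n)).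
Proof.
move=> x0.
have ex m : (x / 2) ^+ m / m`!%:R <= expR x / 2 ^+ m.
  rewrite ler_pdivlMr ?exprn_gt0// mulrAC -exprMn divfK//.
  exact: expR_ge_exp_coeff.
have bnd m : `|besselJ_coeff n x (i + m)%N|
    <= expR (2 * x) / 2 ^+ (i.*2 + n) / 2 ^+ m.
  rewrite /besselJ_coeff !normrM normrX normrN1 expr1n mul1r.
  rewrite ger0_norm ?invr_ge0// normrX (ger0_norm (divr_ge0 x0 _))//.
  have := ler_pM _ _ (ex (i + m)%N) (ex (i + m + n)%N).
  rewrite !divr_ge0 ?exprn_ge0 ?divr_ge0// => /(_ isT isT).
  have -> : (2 : R) * x = x + x by ring.
  rewrite expRD natrM invfM -addnn !exprD => h.
  (* The bound decays like 4^-m; one factor 2^-m is given up to fit [geometric_tail]. *)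
  have e2 : ((2 : R) ^+ m) ^-1 <= 1.
    by rewrite invf_le1 ?exprn_gt0// exprn_ege1 ?ler1n.
  rewrite -[i.*2]addnn [in X in _ <= X]exprD.
  apply: (@le_trans _ _ ((x / 2) ^+ i * (x / 2) ^+ m / (i + m)`!%:R *
    ((x / 2) ^+ i * (x / 2) ^+ m * (x / 2) ^+ n / (i + m + n)`!%:R))).
    by rewrite le_eqVlt; apply/orP; left; apply/eqP; ring.
  apply: (le_trans h).
  have -> : expR x / (2 ^+ i * 2 ^+ m) * (expR x / (2 ^+ i * 2 ^+ m * 2 ^+ n)) =
    expR x * expR x / (2 ^+ i * 2 ^+ i * 2 ^+ n) / 2 ^+ m * (2 ^+ m)^-1.
    by rewrite !invfM; ring.
  by rewrite ler_piMr// !mulr_ge0 ?invr_ge0 ?mulr_ge0 ?exprn_ge0 ?expR_ge0.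
have [_] := geometric_tail bnd.
by rewrite lim_besselJ_coeff series_besselJ_coeff.
Qed.

(** Product and chain rules with C_n' = C_(n+1). At n = 0 the truncated exponent [n.-1] is harmless,
    because its factor n vanishes. *)
Lemma is_derive_besselN (R : realType) n (x : R) :
  is_derive x 1 (besselN n) (n%:R / 2 * (x / 2) ^+ n.-1 *
    bessel_clifford n (- (x / 2) ^+ 2) -
    (x / 2) ^+ n.+1 * bessel_clifford n.+1 (- (x / 2) ^+ 2)).
Proof.
have dh : is_derive x 1 (fun y : R => y / 2) (2^-1).
  have := is_deriveM (is_derive_id x 1) (is_derive_cst (2^-1 : R) x 1).
  by move=> /is_derive_eq; apply; rewrite /= scaler0 add0r [LHS]mulr1.
have dn := is_deriveX n dh.
have d2 := @is_derive1_comp _ (bessel_clifford n) (fun y => - (y / 2) ^+ 2) x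
  _ _ (is_derive_bessel_clifford n _) (is_deriveN (is_deriveX 2 dh)).
have := is_deriveM dn d2.
rewrite [X in is_derive _ _ X _](_ : _ = besselN n); last first.
  by apply/funext => y; rewrite /besselN /= !fctE.
move=> /is_derive_eq; apply; rewrite !fctE /=.
change ((x / 2) ^+ n * (bessel_clifford n.+1 (- (x / 2) ^+ 2) *
    - (2 * (x / 2) ^+ 1 / 2)) +
  bessel_clifford n (- (x / 2) ^+ 2) * (n%:R * (x / 2) ^+ n.-1 / 2) =
  n%:R / 2 * (x / 2) ^+ n.-1 * bessel_clifford n (- (x / 2) ^+ 2) -
  (x / 2) ^+ n.+1 * bessel_clifford n.+1 (- (x / 2) ^+ 2)).
by rewrite expr1 (exprS _ n); field.
Qed.

Lemma is_derive_besselN0 (R : realType) (x : R) :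
  is_derive x 1 (besselN 0) (- besselN 1 x).
Proof.
apply: is_derive_eq (is_derive_besselN 0 x) _.
by rewrite !mul0r sub0r.
Qed.

(** This is [bessel_cliffordS] at y = -(x/2)^2, kept multiplied by x so that it includes x = 0. *)
Lemma besselN_rec (R : realType) n (x : R) :
  x * (besselN n x + besselN n.+2 x) = 2 * n.+1%:R * besselN n.+1 x.
Proof.
rewrite /besselN (bessel_cliffordS n) !exprS.
by have : (2 : R) != 0 by []; move=> ?; field.
Qed.

Lemma is_derive_besselNS (R : realType) n (x : R) :
  is_derive x 1 (besselN n.+1) ((besselN n x - besselN n.+2 x) / 2).
Proof.
apply: is_derive_eq (is_derive_besselN n.+1 x) _.
rewrite /besselN (bessel_cliffordS n) !exprS /=.
by field.
Qed.

Lemma is_derive_besselN1 (R : realType) (x : R) : x != 0 ->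
  is_derive x 1 (besselN 1) (besselN 0 x - besselN 1 x / x).
Proof.
move=> x0; apply: is_derive_eq (is_derive_besselNS 0 x) _.
have := besselN_rec 0 x; rewrite mulr1 => h.
by apply: (mulfI x0); rewrite mulrBr [x * (_ / x)]mulrC divfK//; lra.
Qed.

Lemma continuous_besselN (R : realType) n : continuous (@besselN R n).
Proof.
move=> x; apply: differentiable_continuous; apply/derivable1_diffP.
by have [] := is_derive_besselN n x.
Qed.

Lemma besselN_at0 (R : realType) n : besselN n (0 : R) = (n == 0%N)%:R.
Proof.
rewrite /besselN mul0r !expr0n /=; case: n => [|n]; last by rewrite mul0r.
rewrite mul1r oppr0 /bessel_clifford.
apply/cvg_lim => //; apply: cvg_near_cst; exists 1%N => // -[//|m] _.
rewrite /pseries /series/= big_nat_recl//= big1 ?addr0; last first.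
  by move=> i _; rewrite expr0n /= mulr0.
by rewrite /bessel_clifford_coeff expr0 mulr1 invr1.
Qed.

Lemma besselN_bound (R : realType) n (x : R) : 0 <= x ->
  `|besselN n x| <= 2 * (expR (2 * x) / 2 ^+ n).
Proof.
move=> x0; have := besselN_tail n 0 x0.
by rewrite /besselN_trunc /pseries /series/= big_geq// mulr0 subr0.
Qed.

(** * Neumann's identity and the bound on J_l for nonzero order *)

Lemma is_derive_mul (R : realType) (f g : R -> R) (x df dg : R) :
  is_derive x 1 f df -> is_derive x 1 g dg ->
  is_derive x 1 (fun y => f y * g y) (f x * dg + g x * df).
Proof. exact: is_deriveM. Qed.

Lemma is_derive_sqr (R : realType) (f : R -> R) (x df : R) :
  is_derive x 1 f df -> is_derive x 1 (fun y => f y ^+ 2) (2 * f x * df).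
Proof. by move=> fx; apply: is_derive_eq (is_derive_mul fx fx) _; ring. Qed.

Lemma is_derive_continuous_within (R : realType) (f df : R -> R) (a b : R) :
  (forall x, a <= x <= b -> is_derive x 1 f (df x)) ->
  {within `[a, b], continuous f}.
Proof.
move=> fdf; apply: derivable_within_continuous => x.
by rewrite in_itv/= => /fdf[].
Qed.

(* Partial sums of Neumann's identity [J_0^2 + 2 (J_1^2 + J_2^2 + ...) = 1]:
   by the recurrence for [J_n'] the derivative telescopes. *)
Lemma is_derive_besselN_sqr_sum (R : realType) L (x : R) :
  is_derive x 1
    (fun y => besselN 0 y ^+ 2 + 2 * \sum_(0 <= k < L) besselN k.+1 y ^+ 2)
    (- 2 * besselN L x * besselN L.+1 x).
Proof.
elim: L => [|L IH].
  rewrite (_ : (fun y => _) = (fun y => besselN 0 y ^+ 2)); last first.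
    by apply/funext => y; rewrite big_geq// mulr0 addr0.
  by apply: is_derive_eq (is_derive_sqr (is_derive_besselN0 x)) _; ring.
have d := is_derive_sqr (is_derive_besselNS L x).
rewrite [X in is_derive _ _ X _](_ : _ =
  (fun y => (besselN 0 y ^+ 2 + 2 * \sum_(0 <= k < L) besselN k.+1 y ^+ 2)
     + 2 * besselN L.+1 y ^+ 2)); last first.
  by apply/funext => y; rewrite big_nat_recr//= mulrDr addrA.
have := is_deriveD IH (is_derive_mul (is_derive_cst (2 : R) x 1) d).
by move=> /is_derive_eq; apply; rewrite /cst; field.
Qed.

(** By the mean value theorem, the partial sum of Neumann's identity equals 1 - 2 x J_L(c)
    J_(L+1)(c) for some c in [0, x]. It contains 2 J_(l+1)^2 once L > l, and the remainder vanishes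
    as L grows. *)
Lemma besselN_sqr_le_half (R : realType) l (x : R) : 0 <= x ->
  besselN l.+1 x ^+ 2 <= 1 / 2.
Proof.
move=> x0.
have key L : (l < L)%N ->
    2 * besselN l.+1 x ^+ 2 - 1 <= 8 * x * expR (2 * x) ^+ 2 / 2 ^+ L.
  move=> lL.
  have dP (y : R) := is_derive_besselN_sqr_sum L y.
  have [c] := MVT_segment x0 (fun y _ => dP y)
    (is_derive_continuous_within (fun y _ => dP y)).
  rewrite in_itv/= => /andP[c0 cx].
  have e0 : \sum_(0 <= k < L) besselN k.+1 (0 : R) ^+ 2 = 0.
    by rewrite big1// => i _; rewrite besselN_at0 expr0n.
  rewrite besselN_at0 eqxx expr1n e0 mulr0 addr0 subr0.
  move=> e.
  have : 2 * besselN l.+1 x ^+ 2 <= besselN 0 x ^+ 2 +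
      2 * \sum_(0 <= k < L) besselN k.+1 x ^+ 2.
    rewrite -[leLHS]add0r lerD ?sqr_ge0// ler_pM2l//.
    rewrite big_mkord (bigD1 (Ordinal lL))//= lerDl sumr_ge0// => i _.
    exact: sqr_ge0.
  suff : - 2 * besselN L c * besselN L.+1 c * x
      <= 8 * x * expR (2 * x) ^+ 2 / 2 ^+ L by lra.
  apply: le_trans (ler_norm _) _.
  rewrite 3!normrM normrN (ger0_norm x0) normr_nat.
  (* The point [c] depends on [L], so the bounds are moved to [x] to be uniform in [L]. *)
  have ec : expR (2 * c) <= expR (2 * x) by rewrite ler_expR ler_pM2l.
  have b1 : `|besselN L c| <= 2 * (expR (2 * x) / 2 ^+ L).
    apply: le_trans (besselN_bound _ c0) _.
    by rewrite ler_pM2l// ler_pM2r// invr_gt0 exprn_gt0.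
  have b2 : `|besselN L.+1 c| <= 2 * expR (2 * x).
    apply: le_trans (besselN_bound _ c0) _; rewrite ler_pM2l//.
    apply: le_trans ec; rewrite ler_pdivrMr ?exprn_gt0// ler_peMr ?expR_ge0//.
    by rewrite exprn_ege1// ler1n.
  have -> : 8 * x * expR (2 * x) ^+ 2 / 2 ^+ L =
     2 * (2 * (expR (2 * x) / 2 ^+ L)) * (2 * expR (2 * x)) * x by ring.
  by rewrite ler_wpM2r// ler_pM ?mulr_ge0// ler_pM2l.
have cv : (fun L => 8 * x * expR (2 * x) ^+ 2 / 2 ^+ L) @ \oo --> (0 : R).
  rewrite -(mulr0 (8 * x * expR (2 * x) ^+ 2)); apply: cvgM; first exact: cvg_cst.
  under eq_fun do rewrite -exprVn.
  by apply: cvg_expr; rewrite ger0_norm ?invr_ge0// invf_lt1// ltr1n.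
suff : 2 * besselN l.+1 x ^+ 2 - 1 <= 0 by lra.
rewrite -(cvg_lim _ cv)//; apply: limr_ge; first by apply/cvg_ex; eexists; exact: cv.
by exists l.+1 => // L /= lL; exact: key.
Qed.

(** * Numerical estimates and the decay of J_0 *)

Lemma bessel_clifford_trunc (R : realType) n M (y : R) : `|y| <= 1 / 2 ->
  `|bessel_clifford n y - pseries (bessel_clifford_coeff n) y M| <=
  2 * (bessel_clifford_coeff n M * `|y| ^+ M).
Proof.
(* The coefficients decrease and |y| <= 1/2, so the tail is geometric from the first omitted term
   on. *)
move=> y2; have [m|_] := @geometric_tail _
  (fun i => bessel_clifford_coeff n i * y ^+ i) M (bessel_clifford_coeff n M * `|y| ^+ M); last exact.
rewrite normrM normrX gtr0_norm ?bessel_clifford_coeff_gt0// exprD mulrA.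
rewrite -exprVn ler_pM ?mulr_ge0 ?exprn_ge0 ?(ltW (bessel_clifford_coeff_gt0 _ _ _))//.
  rewrite ler_wpM2r ?exprn_ge0// lef_pV2 ?posrE ?ltr0n ?muln_gt0 ?fact_gt0//.
  by rewrite ler_nat leq_mul// leq_fact// ?leq_add2r leq_addr.
by rewrite lerXn2r ?nnegrE ?invr_ge0//; lra.
Qed.

Lemma bessel_clifford_coeff_eval (R : realType) n m k :
  (m`! * (m + n)`!)%N = k -> bessel_clifford_coeff n m = k%:R^-1 :> R.
Proof. by move=> <-. Qed.

(** The energy used in [besselN0_decay] blows up at 0, so the interval [0, 1] is settled directly
    from the power series. *)
Lemma besselN0_decay_unit (R : realType) (x : R) : 0 <= x -> x <= 1 ->
  x * besselN 0 x ^+ 2 <= 3 / 4.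
Proof.
move=> x0 x1.
have xx : 0 <= (x / 2) ^+ 2 <= 1 / 4 by apply/andP; split; nra.
have := @bessel_clifford_trunc R 0 2 (- (x / 2) ^+ 2).
rewrite normrN (ger0_norm (sqr_ge0 _)) /besselN expr0 mul1r.
rewrite /pseries /series/= !big_nat_recl//= big_geq//.
rewrite !expr0 !expr1 !(@bessel_clifford_coeff_eval _ 0 0 1)//
  !(@bessel_clifford_coeff_eval _ 0 1 1)// !(@bessel_clifford_coeff_eval _ 0 2 4)//.
rewrite ler_norml.
set B := bessel_clifford _ _; set v := (x / 2) ^+ 2 in xx *.
move=> /(_ ltac:(lra))/andP[B1 B2].
have ev : v = x * x / 4 by rewrite /v; field.
have B3 : 0 <= B by nra.
(* Two terms of the series give B <= 1 - v + v^2 / 2, and v <= 1/4 turns this into 1 - 7 v / 8. On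
   each of the three ranges of x below, B is then replaced by a constant valid from the left
   endpoint on. *)
have B4 : B <= 1 - 7 / 32 * (x * x) by nra.
rewrite mul1r expr2.
have BB c : 0 <= c -> B <= c -> B * B <= c * c by move=> c0 Bc; rewrite ler_pM.
have [h|h] := leP x (3 / 4).
  by have := BB 1 ltac:(lra) ltac:(nra); nra.
have [h'|h'] := leP x (9 / 10).
  by have := BB (22 / 25) ltac:(lra) ltac:(nra); nra.
by have := BB (5 / 6) ltac:(lra) ltac:(nra); nra.
Qed.

(** The left side is G(1) for the energy [G] of [besselN0_decay]; it is about 0.735, and three terms
    of each series suffice. *)
Lemma besselN01_at1 (R : realType) :
  besselN 0 (1 : R) ^+ 2 + besselN 1 1 ^+ 2 - besselN 0 1 * besselN 1 1
  + besselN 0 1 ^+ 2 / 2 <= 3 / 4.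
Proof.
have := @bessel_clifford_trunc R 0 3 (- (1 / 2) ^+ 2).
have := @bessel_clifford_trunc R 1 3 (- (1 / 2) ^+ 2).
rewrite normrN (ger0_norm (sqr_ge0 _)) /besselN expr0 mul1r expr1.
rewrite /pseries /series/= !big_nat_recl//= !big_geq//.
rewrite !expr0 !expr1 !(@bessel_clifford_coeff_eval _ 0 0 1)//
  !(@bessel_clifford_coeff_eval _ 0 1 1)// !(@bessel_clifford_coeff_eval _ 0 2 4)//
  !(@bessel_clifford_coeff_eval _ 0 3 36)// !(@bessel_clifford_coeff_eval _ 1 0 1)//
  !(@bessel_clifford_coeff_eval _ 1 1 2)// !(@bessel_clifford_coeff_eval _ 1 2 12)//
  !(@bessel_clifford_coeff_eval _ 1 3 144)//.
rewrite !ler_norml.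
(* [B] is C_1(-1/4) = 2 J_1(1), and [A] is C_0(-1/4) = J_0(1). *)
set B := bessel_clifford _ _.
set A := bessel_clifford _ _.
move=> /(_ ltac:(lra))/andP[B1 B2] /(_ ltac:(lra))/andP[A1 A2].
have a1 : A <= 767 / 1000 by lra.
have a0 : 764 / 1000 <= A by lra.
have b1 : B <= 881 / 1000 by lra.
have b0 : 879 / 1000 <= B by lra.
by nra.
Qed.

Lemma besselN0_decay (R : realType) (x : R) : 0 <= x ->
  x * besselN 0 x ^+ 2 <= 3 / 4.
Proof.
move=> x0; have [x1|x1] := leP x 1; first exact: besselN0_decay_unit.
(* [u = sqrt r * J_0 r] solves [u'' + q u = 0] with [q = 1 + 1 / (4 r^2)]
   decreasing, and [G = u'^2 + q u^2], so [G' = q' u^2 <= 0]. *)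
pose G (r : R) := r * (besselN 0 r ^+ 2 + besselN 1 r ^+ 2)
  - besselN 0 r * besselN 1 r + besselN 0 r ^+ 2 / (2 * r).
have dG r : 1 <= r <= x -> is_derive r 1 G (- besselN 0 r ^+ 2 / (2 * r ^+ 2)).
  move=> /andP[r1 _]; have r0 : r != 0 by rewrite gt_eqF// (lt_le_trans ltr01).
  have d0 := is_derive_besselN0 r.
  have d1 := is_derive_besselN1 r0.
  have dsq := is_deriveD (is_derive_sqr d0) (is_derive_sqr d1).
  have dV : is_derive r 1 (fun y : R => (2 * y)^-1) (- 2 / (2 * r) ^+ 2).
    have r2 : 2 * r != 0 by rewrite mulf_neq0.
    have := @is_deriveV _ (fun y : R => 2 * y) r _ _ r2
      (is_derive_mul (is_derive_cst (2 : R) r 1) (is_derive_id r 1)).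
    move=> /is_derive_eq; apply; rewrite -[LHS]/(- (2 * r) ^- 2 * (2 * 1 + r * 0)).
    by field.
  have := is_deriveD (is_deriveB (is_derive_mul (is_derive_id r 1) dsq)
    (is_derive_mul d0 d1)) (is_derive_mul (is_derive_sqr d0) dV).
  move=> /is_derive_eq; apply => /=.
  by rewrite !fctE; field.
have [|c] := @MVT_segment _ G (fun r => - besselN 0 r ^+ 2 / (2 * r ^+ 2)) 1 x
  (ltW x1) _ (is_derive_continuous_within dG).
  by move=> r; rewrite in_itv/= => /andP[r1 rx]; apply: dG; rewrite !ltW.
rewrite in_itv/= => /andP[c1 cx] e.
have {e} Gx : G x <= G 1.
  rewrite -subr_le0 e mulr_le0_ge0 ?subr_ge0 ?(ltW x1)//.
  by rewrite mulNr oppr_le0 divr_ge0 ?sqr_ge0// mulr_ge0 ?sqr_ge0.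
have G1 : G 1 <= 3 / 4.
  by rewrite /G mul1r mulr1; exact: besselN01_at1.
apply: le_trans G1; apply: le_trans Gx; rewrite /G.
set a := besselN 0 x; set b := besselN 1 x.
have x2 : 0 < x by lra.
(* Removing u^2 = x J_0^2 from [G] leaves u'^2 + u^2 / (4 x^2), written here as squares over x. *)
rewrite -subr_ge0.
have -> : x * (a ^+ 2 + b ^+ 2) - a * b + a ^+ 2 / (2 * x) - x * a ^+ 2 =
  ((x * b - a / 2) ^+ 2 + a ^+ 2 / 4) / x by field; rewrite gt_eqF.
by rewrite divr_ge0 ?addr_ge0 ?sqr_ge0 ?divr_ge0 ?sqr_ge0 // ltW.
Qed.

(** * The Eckart-Young inequality *)

Section square_integrable.
Context d (T : measurableType d) (R : realType) (m : {measure set T -> \bar R}).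
Implicit Types f g : T -> R.

Definition square_integrable f :=
  measurable_fun setT f /\ m.-integrable setT (fun x => (f x ^+ 2)%:E).

Definition inner_product f g : R := \int[m]_x (f x * g x).

Lemma square_integrableP f : measurable_fun setT f ->
  (\int[m]_x (f x ^+ 2)%:E < +oo)%E -> square_integrable f.
Proof.
move=> mf foo; split=> //; apply/integrableP; split.
  by apply/measurable_EFinP; exact: measurable_funX.
under eq_integral do rewrite gee0_abs ?lee_fin ?sqr_ge0//.
exact: foo.
Qed.

Lemma square_integrableM f g : square_integrable f -> square_integrable g ->
  m.-integrable setT (fun x => (f x * g x)%:E).
Proof.
move=> [mf f2] [mg g2]; apply: le_integrable (integrableD _ f2 g2) => //.
  by apply/measurable_EFinP; exact: measurable_funM.
move=> x _; rewrite -EFinD lee_fin [leRHS]ger0_norm ?addr_ge0 ?sqr_ge0//.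
by rewrite ler_norml; apply/andP; split; nra.
Qed.

Lemma square_integrableZ c f :
  square_integrable f -> square_integrable (fun x => c * f x).
Proof.
move=> [mf f2]; split; first exact: measurable_funM.
under eq_fun do rewrite exprMn EFinM.
exact: integrableZl.
Qed.

Lemma square_integrableD f g : square_integrable f -> square_integrable g ->
  square_integrable (fun x => f x + g x).
Proof.
move=> If Ig; have [mf f2] := If; have [mg g2] := Ig.
split; first exact: measurable_funD.
have If2 := integrableD measurableT (integrableD measurableT f2 g2)
  (integrableZl measurableT 2 (square_integrableM If Ig)).
apply: eq_integrable If2 => // x _.
by rewrite /= -EFinM -!EFinD; congr (_%:E); ring.
Qed.

Lemma square_integrable0 : square_integrable (fun=> 0).
Proof.
split=> //; under eq_fun do rewrite expr0n; exact: integrable0.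
Qed.

Lemma square_integrable_sum I (s : seq I) (f : I -> T -> R) :
  (forall i, square_integrable (f i)) ->
  square_integrable (fun x => \sum_(i <- s) f i x).
Proof.
move=> If; elim: s => [|i s IH].
  by under eq_fun do rewrite big_nil; exact: square_integrable0.
by under eq_fun do rewrite big_cons; exact: square_integrableD.
Qed.

Lemma inner_productC f g : inner_product f g = inner_product g f.
Proof. by apply: eq_Rintegral => x _; rewrite mulrC. Qed.

Lemma inner_product_suml I (s : seq I) (c : I -> R) (f : I -> T -> R) g :
  (forall i, square_integrable (f i)) -> square_integrable g ->
  inner_product (fun x => \sum_(i <- s) c i * f i x) g =
  \sum_(i <- s) c i * inner_product (f i) g.
Proof.
move=> If Ig; elim: s => [|i s IH].
  rewrite big_nil /inner_product; under eq_Rintegral do rewrite big_nil mul0r.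
  by rewrite /Rintegral integral0.
rewrite big_cons -IH /inner_product -RintegralZl//; last exact: square_integrableM.
rewrite -RintegralD//.
- by apply: eq_Rintegral => x _; rewrite big_cons mulrDl mulrA.
- have := square_integrableM (square_integrableZ (c i) (If i)) Ig.
  by apply: eq_integrable => // x _; rewrite /= mulrA.
- apply: square_integrableM => //; apply: square_integrable_sum => j.
  exact: square_integrableZ.
Qed.

Lemma inner_productBr f g h :
  square_integrable f -> square_integrable g -> square_integrable h ->
  inner_product f (fun x => g x - h x) = inner_product f g - inner_product f h.
Proof.
move=> If Ig Ih; rewrite /inner_product -RintegralB//; try exact: square_integrableM.
by apply: eq_Rintegral => x _; rewrite mulrBr.
Qed.

(** Integrates (t f + g)^2 >= 0 and (t f - g)^2 >= 0. The free weight t replaces Cauchy-Schwarz and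
    avoids square roots of inner products. *)
Lemma inner_product_young f g (t : R) :
  square_integrable f -> square_integrable g -> 0 < t ->
  `|inner_product f g| <= (t * inner_product f f + inner_product g g / t) / 2.
Proof.
move=> If Ig t0; have fg := square_integrableM If Ig.
have ff := square_integrableM If If; have gg := square_integrableM Ig Ig.
have tf : m.-integrable setT (EFin \o (fun x => t * (f x * f x))).
  exact: (integrableZl measurableT t ff).
have tg : m.-integrable setT (EFin \o (fun x => g x * g x / t)).
  have := integrableZl measurableT t^-1 gg.
  by apply: eq_integrable => // x _; rewrite /= -EFinM mulrC.
have tfg : m.-integrable setT
    (EFin \o (fun x => t * (f x * f x) + g x * g x / t)).
  exact: (integrableD measurableT tf tg).
apply: le_trans (le_normr_Rintegral _ fg) _ => //.
rewrite -RintegralZl// -RintegralZr// -RintegralD// -RintegralZr//.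
apply: le_Rintegral => //.
- exact: integrable_norm.
- have := integrableZl measurableT 2^-1 tfg.
  by apply: eq_integrable => // x _; rewrite /= -EFinM mulrC.
- move=> x _; rewrite ler_norml -subr_ge0 -[X in _ && X]subr_ge0.
  apply/andP; split.
    rewrite (_ : _ - _ = (t * f x + g x) ^+ 2 / t / 2); last first.
      by field; rewrite gt_eqF.
    by rewrite !divr_ge0 ?sqr_ge0// ltW.
  rewrite (_ : _ - _ = (t * f x - g x) ^+ 2 / t / 2); last first.
    by field; rewrite gt_eqF.
  by rewrite !divr_ge0 ?sqr_ge0// ltW.
Qed.

End square_integrable.

(** * Products f(x) g(y) on a product space *)

Section tensor_product.
Context d1 d2 (T1 : measurableType d1) (T2 : measurableType d2) (R : realType).
Variables (m1 : {sigma_finite_measure set T1 -> \bar R}).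
Variables (m2 : {sigma_finite_measure set T2 -> \bar R}).

Definition tensor (f : T1 -> R) (g : T2 -> R) (p : T1 * T2) : R := f p.1 * g p.2.

Lemma measurable_tensor f g : measurable_fun setT f -> measurable_fun setT g ->
  measurable_fun setT (tensor f g).
Proof.
by move=> mf mg; apply: measurable_funM; exact: measurableT_comp.
Qed.

Lemma integrable_tensor f g :
  m1.-integrable setT (EFin \o f) -> m2.-integrable setT (EFin \o g) ->
  (m1 \x m2)%E.-integrable setT (EFin \o tensor f g).
Proof.
move=> If Ig; have [mf foo] := integrableP _ _ _ If.
have [mg goo] := integrableP _ _ _ Ig.
apply/integrable12ltyP.
  by apply/measurable_EFinP; apply: measurable_tensor; exact/measurable_EFinP.
have -> : (fun x => \int[m2]_y `|(EFin \o tensor f g) (x, y)|)%E =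
  (fun x => `|(f x)%:E| * \int[m2]_y `|(g y)%:E|)%E.
  apply/funext => x; rewrite -ge0_integralZl//; last first.
    exact: measurableT_comp.
  by apply: eq_integral => y _; rewrite /tensor /= normrM EFinM.
have [c ec] : exists c, (\int[m2]_y `|(g y)%:E|)%E = c%:E.
  exists (fine (\int[m2]_y `|(g y)%:E|)).
  by rewrite fineK// ge0_fin_numE// integral_ge0.
rewrite ec; under eq_integral do rewrite muleC.
have c0 : (0 <= c%:E)%E by rewrite -ec integral_ge0.
rewrite ge0_integralZl//; first by apply: lte_mul_pinfty.
exact: measurableT_comp.
Qed.

Lemma Rintegral_tensor f g :
  m1.-integrable setT (EFin \o f) -> m2.-integrable setT (EFin \o g) ->
  \int[(m1 \x m2)%E]_p tensor f g p = \int[m1]_x f x * \int[m2]_y g y.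
Proof.
move=> If Ig; rewrite /Rintegral -integral12_prod_meas1; last exact: integrable_tensor.
have fg : (\int[m2]_y (g y)%:E)%E \is a fin_num.
  exact: integrable_fin_num.
have ff : (\int[m1]_x (f x)%:E)%E \is a fin_num.
  exact: integrable_fin_num.
have -> : fubini_F m2 (fun x => (tensor f g x)%:E) =
    (fun x => (\int[m2]_y (g y)%:E) * (f x)%:E)%E.
  by apply/funext => x; rewrite /fubini_F muleC -integralZl.
by rewrite -(fineK fg) integralZl// fineM// mulrC.
Qed.

Lemma inner_product_tensor f f' g g' :
  square_integrable m1 f -> square_integrable m1 f' ->
  square_integrable m2 g -> square_integrable m2 g' ->
  inner_product (m1 \x m2)%E (tensor f g) (tensor f' g') =
  inner_product m1 f f' * inner_product m2 g g'.
Proof.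
move=> If If' Ig Ig'; rewrite -Rintegral_tensor; try exact: square_integrableM.
by apply: eq_Rintegral => p _; rewrite /tensor mulrACA.
Qed.

Lemma square_integrable_tensor f g :
  square_integrable m1 f -> square_integrable m2 g ->
  square_integrable (m1 \x m2)%E (tensor f g).
Proof.
move=> [mf If] [mg Ig]; split; first exact: measurable_tensor.
have := integrable_tensor If Ig; apply: eq_integrable => // p _.
by rewrite /tensor/= exprMn.
Qed.

End tensor_product.

(** The n+1 rows in dimension n are linearly dependent; a nonzero vector of the left kernel is
    divided by its norm. *)
Lemma unit_row_kernel (R : rcfType) n (M : 'M[R]_(n.+1, n)) :
  exists c : 'I_n.+1 -> R,
    (forall m, \sum_i c i * M i m = 0) /\ \sum_i c i ^+ 2 = 1.
Proof.
pose r := nz_row (kermx M).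
have r0 : r != 0.
  rewrite nz_row_eq0 -mxrank_eq0 mxrank_ker -lt0n subn_gt0 ltnS.
  exact: rank_leq_col.
have rM : r *m M = 0 by apply/sub_kermxP; exact: nz_row_sub.
pose s := \sum_i r 0 i ^+ 2.
have s0 : 0 < s.
  have [i ri] : exists i, r 0 i != 0.
    apply/existsP; rewrite -negb_forall; apply: contra r0 => /forallP r0.
    by apply/eqP/rowP => i; rewrite mxE; exact/eqP.
  rewrite /s (bigD1 i)//= ltr_pwDl ?sumr_ge0//; last by move=> *; exact: sqr_ge0.
  by rewrite exprn_even_gt0.
exists (fun i => r 0 i / Num.sqrt s); split=> [m|].
  move/rowP : rM => /(_ m); rewrite !mxE => rM.
  under eq_bigr do rewrite mulrAC; rewrite -mulr_suml rM mul0r//.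
under eq_bigr do rewrite exprMn; rewrite -mulr_suml exprVn sqr_sqrtr ?ltW//.
by rewrite mulfV// gt_eqF.
Qed.

(** * Singular values against approximation by finite rank kernels *)

Section eckart_young.
Context d1 d2 (T1 : measurableType d1) (T2 : measurableType d2) (R : realType).
Variables (m1 : {sigma_finite_measure set T1 -> \bar R}).
Variables (m2 : {sigma_finite_measure set T2 -> \bar R}).
Let m := (m1 \x m2)%E.

Lemma inner_product_le (f : T1 * T2 -> R) (B : R) : square_integrable m f ->
  (\int[m]_p (f p ^+ 2)%:E <= B%:E)%E -> inner_product m f f <= B.
Proof.
move=> If fB; rewrite -lee_fin; apply: le_trans fB.
by rewrite /inner_product /Rintegral fineK//; apply: integrable_fin_num => //;
  exact: square_integrableM.
Qed.

(* Some unit [c] in [R^(n+1)] makes [f = sum_i c_i u_i] orthogonal to every [a_i].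
   With [h = sum_i c_i v_i], testing [g] against [f h] gives
   [sum_i c_i^2 S_i >= S_n], while the rank [n] approximant contributes nothing. *)
Lemma singular_value_le (u : nat -> T1 -> R) (S : nat -> R) (v : nat -> T2 -> R)
    (g : T1 * T2 -> R) n (a : 'I_n -> T1 -> R) (b : 'I_n -> T2 -> R) (B : R) :
  (forall i, square_integrable m1 (u i)) ->
  (forall i j, inner_product m1 (u i) (u j) = (i == j)%:R) ->
  (forall i, square_integrable m2 (v i)) ->
  (forall i j, inner_product m2 (v i) (v j) = (i == j)%:R) ->
  nonincreasing_seq S -> 0 < S n ->
  (forall i, square_integrable m1 (a i)) ->
  (forall i, square_integrable m2 (b i)) ->
  measurable_fun setT g ->
  (\int[m]_p ((g p - \sum_(i < N) S i * tensor (u i) (v i) p) ^+ 2)%:E)%E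
    @[N --> \oo] --> 0%E ->
  (\int[m]_p ((g p - \sum_(i < n) tensor (a i) (b i) p) ^+ 2)%:E <= B%:E)%E ->
  S n ^+ 2 <= B.
Proof.
move=> Iu ou Iv ov dS Sn0 Ia Ib mg cvS gB.
have [c [c0 c1]] := unit_row_kernel
  (\matrix_(i < n.+1, k < n) inner_product m1 (u i) (a k)).
pose f x := \sum_(i < n.+1) c i * u i x.
pose h y := \sum_(i < n.+1) c i * v i y.
have If : square_integrable m1 f.
  by apply: square_integrable_sum => i; exact: square_integrableZ.
have Ih : square_integrable m2 h.
  by apply: square_integrable_sum => i; exact: square_integrableZ.
pose F := tensor f h.
have IF : square_integrable m F by exact: square_integrable_tensor.
(* [e] extends [c] by zero to all indices; it gives the coefficients of [f] on the [u j] and of [h]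
   on the [v j]. *)
pose e j := \sum_(i < n.+1) c i * (i == j :> nat)%:R.
have ec (j : 'I_n.+1) : e j = c j.
  rewrite /e (bigD1 j)//= eqxx mulr1 big1 ?addr0// => i ij.
  by rewrite (negbTE ij : (i == j :> nat) = false) mulr0.
have fu j : inner_product m1 f (u j) = e j.
  by rewrite inner_product_suml//; apply: eq_bigr => i _; rewrite ou.
have hv j : inner_product m2 h (v j) = e j.
  by rewrite inner_product_suml//; apply: eq_bigr => i _; rewrite ov.
have FF : inner_product m F F = 1.
  rewrite inner_product_tensor// {1}/f inner_product_suml//.
  rewrite [X in _ * X]inner_product_suml//.
  have -> : \sum_(i < n.+1) c i * inner_product m1 (u i) f = 1.
    by rewrite -c1; apply: eq_bigr => i _; rewrite inner_productC fu ec.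
  have -> : \sum_(i < n.+1) c i * inner_product m2 (v i) h = 1.
    by rewrite -c1; apply: eq_bigr => i _; rewrite inner_productC hv ec.
  by rewrite mulr1.
pose p z := \sum_(i < n) tensor (a i) (b i) z.
have Ip : square_integrable m p.
  by apply: square_integrable_sum => i; exact: square_integrable_tensor.
have Fp : inner_product m F p = 0.
  have -> : p = fun z => \sum_(i < n) 1 * tensor (a i) (b i) z.
    by apply/funext => z; apply: eq_bigr => i _; rewrite mul1r.
  rewrite inner_productC inner_product_suml//; last first.
    by move=> i; exact: square_integrable_tensor.
  rewrite big1// => i _; rewrite mul1r inner_productC inner_product_tensor//.
  have := c0 i; under eq_bigr do rewrite mxE.
  by rewrite -inner_product_suml// => ->; rewrite mul0r.
pose w N z := \sum_(i < N) S i * tensor (u i) (v i) z.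
have Iw N : square_integrable m (w N).
  apply: square_integrable_sum => i; apply: square_integrableZ.
  exact: square_integrable_tensor.
have Fw N : (n < N)%N -> S n <= inner_product m F (w N).
  move=> nN; rewrite inner_productC inner_product_suml//; last first.
    by move=> i; exact: square_integrable_tensor.
  have -> : \sum_(i < N) S i * inner_product m (tensor (u i) (v i)) F =
      \sum_(i < N) S i * e i ^+ 2.
    apply: eq_bigr => i _; congr (_ * _).
    by rewrite inner_productC inner_product_tensor// fu hv expr2.
  (* The terms beyond n vanish; the others have weights c_i^2 of sum 1 and S_i >= S_n. *)
  rewrite -(big_mkord xpredT (fun i => S i * e i ^+ 2)).
  rewrite (big_cat_nat (n := n.+1))//= [X in _ + X]big1_seq ?addr0; last first.
    move=> j; rewrite mem_index_iota => /andP[_ /andP[nj _]].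
    rewrite /e big1 ?expr0n ?mulr0// => i _.
    rewrite (_ : (_ == _) = false) ?mulr0//; apply/negbTE.
    by rewrite ltn_eqF// (leq_trans (ltn_ord i)).
  rewrite big_mkord -[leLHS]mulr1 -c1 mulr_sumr; apply: ler_sum => i _.
  rewrite ec ler_wpM2r ?sqr_ge0//; apply: dS.
  by rewrite -ltnS.
pose q z := g z - p z.
have Iq : square_integrable m q.
  apply: square_integrableP; last by rewrite (le_lt_trans gB)// ltry.
  by apply: measurable_funB => //; have [] := Ip.
have qB : inner_product m q q <= B by exact: inner_product_le.
pose r N z := g z - w N z.
have mr N : measurable_fun setT (r N).
  by apply: measurable_funB => //; have [] := Iw N.
(* As [F] is orthogonal to [p], its product with [w N] is that with [q] minus that with [r N].
   Young's inequality with t = S_n bounds the first, and with t = s the second. Letting s tend to 0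
   then yields S_n <= B / S_n. *)
have key s : 0 < s -> S n <= (S n + B / S n) / 2 + s.
  move=> s0.
  have [N [nN rN]] : exists N,
      (n < N)%N /\ (\int[m]_z (r N z ^+ 2)%:E <= (s ^+ 2)%:E)%E.
    have /fine_cvgP[cf /cvgrPdist_le/(_ _ (exprn_gt0 2 s0)) cr] := cvS.
    have [N _ cN] := filterI cf cr.
    exists (maxn N n.+1); split; first exact: leq_maxr.
    have /= [fN] := cN (maxn N n.+1) (leq_maxl _ _).
    rewrite sub0r normrN => /ler_normlP[_ rN].
    by rewrite -(fineK fN) lee_fin.
  have Ir : square_integrable m (r N).
    by apply: square_integrableP => //; rewrite (le_lt_trans rN)// ltry.
  have rs : inner_product m (r N) (r N) <= s ^+ 2 by exact: inner_product_le.
  have eF : inner_product m F (w N) =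
      inner_product m F q - inner_product m F (r N).
    rewrite -inner_productBr// -[LHS]subr0 -Fp -inner_productBr//.
    congr (inner_product _ _ _); apply/funext => z; rewrite /q /r; ring.
  have /ler_normlP[_ y1] := inner_product_young IF Iq Sn0.
  have /ler_normlP[y2 _] := inner_product_young IF Ir s0.
  have := Fw N nN; rewrite eF FF in y1 y2 *.
  have : inner_product m q q / S n <= B / S n by rewrite ler_pM2r ?invr_gt0.
  have : inner_product m (r N) (r N) / s <= s.
    by rewrite ler_pdivrMr// -expr2.
  lra.
have : S n <= (S n + B / S n) / 2.
  by apply/ler_addgt0Pr => s /key.
have : S n ^+ 2 = S n * S n by [].
have := mulfVK (lt0r_neq0 Sn0) B => e1.
have : B / S n * S n = B by rewrite mulrVK// unitfE gt_eqF.
nra.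
Qed.

End eckart_young.

(** * Radial kernels *)

Section radial_lift.
Context (R : realType).
Notation mu := (@lebesgue_measure R).
Implicit Types (a : R) (f : R -> R).

(* Isometry from [L^2([0, a], r dr)] into [L^2(R)]. *)
Definition radial_lift a f : R -> R :=
  (fun r => f r * Num.sqrt r) \_ `[0, a].

Lemma radial_liftE a f r :
  radial_lift a f r = if 0 <= r <= a then f r * Num.sqrt r else 0.
Proof. by rewrite /radial_lift patchE mem_setE in_itv. Qed.

Lemma radial_liftM a f g :
  (fun r => radial_lift a f r * radial_lift a g r) =
  (fun r => f r * g r * r) \_ `[0, a].
Proof.
apply/funext => r; rewrite /radial_lift /patch.
case: ifPn => [|_]; last by rewrite mulr0.
rewrite inE/= in_itv/= => /andP[r0 _].
by rewrite mulrACA -expr2 sqr_sqrtr.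
Qed.

Lemma integral_radial_liftM a f g :
  (\int[mu]_r (radial_lift a f r * radial_lift a g r)%:E =
   \int[mu]_(r in `[0%R, a]) (f r * g r * r)%:E)%E.
Proof.
rewrite [RHS]integral_mkcond; apply: eq_integral => r _.
have := congr1 (fun F => F r) (radial_liftM a f g) => /= ->.
by rewrite /patch; case: ifP.
Qed.

Lemma measurable_radial_lift a f : measurable_fun `[0, a] f ->
  measurable_fun setT (radial_lift a f).
Proof.
move=> mf; apply/(measurable_restrictT _ _).1 => //.
apply: measurable_funM => //.
apply: measurable_funTS; apply: continuous_measurable_fun; exact: sqrt_continuous.
Qed.

Lemma square_integrable_radial_lift a f : measurable_fun `[0, a] f ->
  (\int[mu]_(r in `[0%R, a]) (f r * f r * r)%:E < +oo)%E ->
  square_integrable mu (radial_lift a f).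
Proof.
move=> mf foo; apply: square_integrableP; first exact: measurable_radial_lift.
by under eq_integral do rewrite expr2; rewrite integral_radial_liftM.
Qed.

Lemma square_integrable_radial_lift_continuous a f : continuous f ->
  square_integrable mu (radial_lift a f).
Proof.
move=> cf; apply: square_integrable_radial_lift.
  by apply: measurable_funTS; exact: continuous_measurable_fun.
have /integrable_lty : mu.-integrable `[0, a] (EFin \o (fun r => f r * f r * r)).
  apply: continuous_compact_integrable; first exact: segment_compact.
  apply: continuous_subspaceT => r; apply: cvgM; last exact: cvg_id.
  by apply: cvgM; exact: cf.
exact.
Qed.

Lemma radial_orthonormal_lift a (f : nat -> R -> R) : radial_orthonormal a f ->
  (forall i, square_integrable mu (radial_lift a (f i))) /\
  (forall i j, inner_product mu (radial_lift a (f i)) (radial_lift a (f j))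
    = (i == j)%:R).
Proof.
move=> [mf of_]; split=> [i|i j].
  by apply: square_integrable_radial_lift => //; rewrite of_ ltry.
by rewrite /inner_product /Rintegral integral_radial_liftM of_.
Qed.

(** Two-variable counterpart of [radial_lift]: it carries the norm of L^2(x dx k dk) on the
    rectangle to that of L^2 on the plane. *)
Definition radial_kernel (D K : R) (g : R -> R -> R) : R * R -> R :=
  (fun p => g p.1 p.2 * (Num.sqrt p.1 * Num.sqrt p.2)) \_ (`[0, D] `*` `[0, K]).

Lemma measurable_radial_kernel D K (g : R -> R -> R) :
  measurable_fun setT (fun p : R * R => g p.1 p.2) ->
  measurable_fun setT (radial_kernel D K g).
Proof.
move=> mg; apply/(measurable_restrictT _ _).1; first exact: measurableX.
apply: measurable_funTS; apply: measurable_funM => //.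
have ms : measurable_fun setT (@Num.sqrt R).
  by apply: continuous_measurable_fun; exact: sqrt_continuous.
by apply: measurable_funM; exact: measurableT_comp.
Qed.

Lemma radial_kernelE D K (g : R -> R -> R) x k : radial_kernel D K g (x, k) =
  if (0 <= x <= D) && (0 <= k <= K) then g x k * (Num.sqrt x * Num.sqrt k) else 0.
Proof. by rewrite /radial_kernel patchE in_setX/= !mem_setE !in_itv. Qed.

Lemma radial_kernel_sum D K (g : R -> R -> R) n (c : 'I_n -> R)
    (a b : 'I_n -> R -> R) p :
  radial_kernel D K g p -
    \sum_(i < n) c i * tensor (radial_lift D (a i)) (radial_lift K (b i)) p =
  radial_kernel D K (fun x k => g x k - \sum_(i < n) a i x * c i * b i k) p.
Proof.
case: p => x k; rewrite /tensor !radial_kernelE.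
under eq_bigr do rewrite !radial_liftE.
case: (0 <= x <= D) => /=; last first.
  by rewrite sub0r big1 ?oppr0// => i _; rewrite mul0r mulr0.
case: (0 <= k <= K) => /=; last first.
  by rewrite sub0r big1 ?oppr0// => i _; rewrite !mulr0.
rewrite mulrBl mulr_suml; congr (_ - _); apply: eq_bigr => i _; ring.
Qed.

Lemma integral_radial_kernel D K (g : R -> R -> R) :
  measurable_fun setT (radial_kernel D K g) ->
  (\int[(mu \x mu)%E]_p (radial_kernel D K g p ^+ 2)%:E =
   \int[mu]_(x in `[0%R, D]) \int[mu]_(k in `[0%R, K])
     (g x k ^+ 2 * k * x)%:E)%E.
Proof.
move=> mg; rewrite fubini_tonelli1; last 2 first.
- by apply/measurable_EFinP; exact: measurable_funX.
- by move=> p; rewrite lee_fin sqr_ge0.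
rewrite [RHS]integral_mkcond; apply: eq_integral => x _.
rewrite /fubini_F patchE mem_setE in_itv/=.
under eq_integral do rewrite radial_kernelE.
case: ifPn => /= [/andP[x0 _]|_]; last first.
  by rewrite integral0_eq// => k _; rewrite expr0n.
rewrite [RHS]integral_mkcond; apply: eq_integral => k _.
rewrite patchE mem_setE in_itv/=.
case: ifPn => [/andP[k0 _]|_]; last by rewrite expr0n.
by rewrite !exprMn !sqr_sqrtr//; congr (_%:E); ring.
Qed.

Lemma integrable_restrict_ge0 a f c : measurable_fun `[0, a] f ->
  (forall x, 0 <= x <= a -> 0 <= f x) ->
  (\int[mu]_(x in `[0%R, a]) (f x)%:E = c%:E)%E ->
  mu.-integrable setT (EFin \o (f \_ `[0, a])).
Proof.
move=> mf f0 fc; rewrite -restrict_EFin.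
apply: (iffLR (@integrable_mkcond _ _ _ mu `[0, a]%classic (EFin \o f) _)) => //.
apply/integrableP; split; first exact/measurable_EFinP.
have -> : (\int[mu]_(x in `[0%R, a]) `|(EFin \o f) x| = c%:E)%E.
  rewrite -fc; apply: eq_integral => x; rewrite mem_setE in_itv/= => /f0 fx.
  by rewrite ger0_norm.
by rewrite ltry.
Qed.

(** Transports [singular_value_le] through the lifts. The majorant of the weighted squared error is
    a product, so its double integral is [ca * cb]. For n = 0 the error is the kernel itself, and
    the bound is one on the Hilbert-Schmidt norm. *)
Lemma radial_svd_le D K (g : R -> R -> R) U S V n (a b : 'I_n -> R -> R)
    (al be : R -> R) (ca cb : R) :
  radial_svd D K g U S V -> measurable_fun setT (fun p : R * R => g p.1 p.2) ->
  (forall i, continuous (a i)) -> (forall i, continuous (b i)) ->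
  measurable_fun `[0, D] al -> measurable_fun `[0, K] be ->
  (forall x, 0 <= x <= D -> 0 <= al x) -> (forall k, 0 <= k <= K -> 0 <= be k) ->
  (\int[mu]_(x in `[0%R, D]) (al x)%:E = ca%:E)%E ->
  (\int[mu]_(k in `[0%R, K]) (be k)%:E = cb%:E)%E ->
  (forall x k, 0 <= x <= D -> 0 <= k <= K ->
    (g x k - \sum_(i < n) a i x * b i k) ^+ 2 * k * x <= al x * be k) ->
  0 < S n -> S n ^+ 2 <= ca * cb.
Proof.
move=> [/radial_orthonormal_lift[IU oU] /radial_orthonormal_lift[IV oV] dS _ cvS].
move=> mg ca_ cb_ mal mbe al0 be0 eal ebe gle Sn0.
have mG := measurable_radial_kernel D K mg.
have Ia i := square_integrable_radial_lift_continuous D (ca_ i).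
have Ib i := square_integrable_radial_lift_continuous K (cb_ i).
apply: (singular_value_le IU oU IV oV dS Sn0 Ia Ib mG).
- apply: cvg_trans cvS; apply: near_eq_cvg; near=> N.
  have mr : measurable_fun setT
      (radial_kernel D K (fun x k => g x k - \sum_(i < N) U i x * S i * V i k)).
    rewrite -(funext (radial_kernel_sum D K g S U V)).
    apply: measurable_funB => //; apply: measurable_sum => i.
    apply: measurable_funM => //.
    by apply: measurable_tensor; [have [] := IU i|have [] := IV i].
  under [RHS]eq_integral do rewrite radial_kernel_sum.
  by rewrite integral_radial_kernel.
have ra : mu.-integrable setT (EFin \o (al \_ `[0, D])).
  exact: integrable_restrict_ge0 eal.
have rb : mu.-integrable setT (EFin \o (be \_ `[0, K])).
  exact: integrable_restrict_ge0 ebe.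
have It := integrable_tensor ra rb.
have eT : (\int[(mu \x mu)%E]_p (tensor (al \_ `[0, D]) (be \_ `[0, K]) p)%:E
    = (ca * cb)%:E)%E.
  rewrite -(fineK (integrable_fin_num measurableT It)); congr (_%:E).
  rewrite -[LHS]/(\int[(mu \x mu)%E]_p _ p) Rintegral_tensor//.
  by rewrite -!Rintegral_mkcond /Rintegral eal ebe.
have e p : radial_kernel D K g p -
    \sum_(i < n) tensor (radial_lift D (a i)) (radial_lift K (b i)) p =
    radial_kernel D K (fun x k => g x k - \sum_(i < n) a i x * b i k) p.
  have := radial_kernel_sum D K g (fun=> 1) a b p.
  under eq_bigr do rewrite mul1r.
  by under [in X in _ = X -> _]eq_fun do
    under eq_fun do under eq_bigr do rewrite mulr1.
rewrite -eT; apply: ge0_le_integral => //.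
- by move=> p _; rewrite lee_fin sqr_ge0.
- apply/measurable_EFinP; apply: measurable_funX; apply: measurable_funB => //.
  apply: measurable_sum => i.
  by apply: measurable_tensor; [have [] := Ia i|have [] := Ib i].
- by case/integrableP : It.
- move=> [x k] _; rewrite lee_fin e radial_kernelE /tensor !patchE !mem_setE !in_itv/=.
  case: ifPn => [/andP[hx hk]|].
    rewrite hx hk; apply: le_trans (gle _ _ hx hk).
    move/andP: hx => [x0 _]; move/andP: hk => [k0 _].
    by rewrite !exprMn !sqr_sqrtr// mulrCA mulrC -mulrA mulrC.
  rewrite negb_and expr0n /=.
  case: ifPn => hx; last by rewrite mul0r.
  by case: ifPn => hk; rewrite ?mulr0//= mulr_ge0 ?al0 ?be0.
Unshelve. all: by end_near. Qed.

End radial_lift.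

(** * Singular values of the Bessel kernels *)

(** From sin y <= y follows cos y = 1 - 2 sin^2(y/2) >= 1 - y^2/2, which says that the difference of
    the two sides has a derivative of constant sign. *)
Lemma sin_ge_taylor3 (R : realType) (x : R) : 0 <= x -> x - x ^+ 3 / 6 <= sin x.
Proof.
have sin_le (y : R) : 0 <= y -> sin y <= y.
  move=> y0.
  have [c _] := MVT_segment y0 (fun t _ => is_derive_sin t)
    (is_derive_continuous_within (fun t _ => is_derive_sin t)).
  by rewrite sin0 !subr0 => ->; rewrite ler_piMl// cos_le1.
have cos_ge (y : R) : 0 <= y -> 1 - y ^+ 2 / 2 <= cos y.
  move=> y0; have y20 : 0 <= y / 2 by rewrite divr_ge0.
  rewrite [y in cos y](_ : y = (y / 2) *+ 2); last by rewrite mulr2n; field.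
  rewrite cos_mulr2n cos2sin2.
  have s1 := sin_le _ y20.
  have s2 : sin (y / 2) ^+ 2 <= (y / 2) ^+ 2.
    have [y1|y1] := leP (y / 2) 1.
      rewrite lerXn2r ?nnegrE// sin_ge0_pi// y20 (le_trans y1)//.
      by rewrite (le_trans _ (pi_ge2 _))// ler1n.
    have := sin_max (y / 2) => /ler_normlP[h1 h2].
    have : sin (y / 2) ^+ 2 <= 1 by nra.
    by move=> /le_trans; apply; rewrite exprn_ege1// ltW.
  have e : (y / 2) ^+ 2 = y ^+ 2 / 4 by field.
  by move: s2; rewrite e; lra.
move=> x0.
have d (t : R) : is_derive t 1 (fun t : R => sin t - (t - t * (t * t) / 6))
    (cos t - (1 - t ^+ 2 / 2)).
  have d3 := is_derive_mul (is_derive_id t 1)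
    (is_derive_mul (is_derive_id t 1) (is_derive_id t 1)).
  have := is_deriveB (is_derive_sin t) (is_deriveB (is_derive_id t 1)
    (is_derive_mul d3 (is_derive_cst (6^-1 : R) t 1))).
  by move=> /is_derive_eq; apply; rewrite /cst /id/=; field.
have [c] := MVT_segment x0 (fun t _ => d t)
  (is_derive_continuous_within (fun t _ => d t)).
rewrite in_itv/= => /andP[/cos_ge c0 _].
rewrite sin0 !mul0r !subr0 => e.
have : 0 <= (cos c - (1 - c ^+ 2 / 2)) * x by rewrite mulr_ge0// subr_ge0.
by rewrite -e; lra.
Qed.

(** Otherwise 8/5 < pi/2 and cos(8/5) > 0; but cos(8/5) = 1 - 2 sin^2(4/5), and sin(4/5) >= 71/100
    exceeds 1 / sqrt 2. *)
Lemma pi_le_16_5 (R : realType) : pi <= 16 / 5 :> R.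
Proof.
rewrite leNgt; apply/negP => pi3.
have c0 : 0 < cos (8 / 5 : R) by apply: cos_gt0_pihalf; apply/andP; split; lra.
move: c0; rewrite [8 / 5 : R](_ : _ = (4 / 5) *+ 2); last by rewrite mulr2n; field.
rewrite cos_mulr2n cos2sin2.
have := @sin_ge_taylor3 R (4 / 5) ltac:(lra) => h.
have : 71 / 100 <= sin (4 / 5 : R) by lra.
by nra.
Qed.

(** The tangent at t = 1 gives exp t >= e t, and e >= (7/6)^6 > 63/25. *)
Lemma expR_ge_mul (R : realType) (t : R) : 0 <= t -> 63 / 25 * t <= expR t.
Proof.
move=> t0.
have e1 : 63 / 25 <= expR 1 :> R.
  have := expR_ge1Dx (1 / 6 : R).
  have -> : expR 1 = expR (1 / 6) ^+ 6 :> R.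
    by rewrite -expRM_natl; congr expR; field.
  move=> h; apply: (@le_trans _ _ ((7 / 6) ^+ 6)); first by lra.
  by rewrite lerXn2r ?nnegrE ?expR_ge0//; lra.
have -> : expR t = expR 1 * expR (t - 1) by rewrite -expRD addrC subrK.
have t1 : t <= expR (t - 1) by have := expR_ge1Dx (t - 1); rewrite addrC subrK.
by apply: ler_pM => //; lra.
Qed.

Lemma integral_itv_cst (R : realType) (a c : R) : 0 <= a ->
  (\int[lebesgue_measure]_(x in `[0%R, a]) c%:E = (c * a)%:E)%E.
Proof.
move=> a0; rewrite integral_cst//= lebesgue_measure_itv/= lte_fin.
case: ltgtP a0 => //= [_ _|<- _]; first by rewrite oppr0 addr0 -EFinM.
by rewrite mule0 mulr0.
Qed.

Lemma integral_itv_id (R : realType) (a c : R) : 0 < a ->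
  (\int[lebesgue_measure]_(x in `[0%R, a]) (c * x)%:E = (c * a ^+ 2 / 2)%:E)%E.
Proof.
move=> a0.
have d (x : R) : is_derive x 1 (fun x : R => c * (x * x) / 2) (c * x).
  have := is_derive_mul (is_derive_mul (is_derive_cst c x 1)
    (is_derive_mul (is_derive_id x 1) (is_derive_id x 1)))
    (is_derive_cst (2^-1 : R) x 1).
  by move=> /is_derive_eq; apply; rewrite /cst /id/=; field.
have cd : continuous (fun x : R => c * (x * x) / 2).
  move=> x; apply: differentiable_continuous; apply/derivable1_diffP.
  by have [] := d x.
rewrite (@continuous_FTC2 _ (fun x => c * x) (fun x => c * (x * x) / 2))//.
- by rewrite -EFinB !mulr0 mul0r subr0 expr2.
- by apply: continuous_subspaceT => x; apply: cvgM; [exact: cvg_cst|exact: cvg_id].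
- split.
  + by move=> x _; have [] := d x.
  + exact/cvg_at_right_filter/cd.
  + exact/cvg_at_left_filter/cd.
- by move=> x _; rewrite derive1E; have [_ ->] := d x.
Qed.

Lemma counting_le (R : realType) (T : choiceType) (A : set T) (h : T -> nat) k :
  {in A &, injective h} -> (forall z, A z -> (h z < k)%N) ->
  (counting A <= (k%:R : R)%:E)%E.
Proof.
move=> hi hk.
have Ak : (A #<= `I_k)%card.
  rewrite -(card_le_eql (inj_card_eq hi)); apply: subset_card_le => _ [z Az <-].
  exact: hk.
have fA : finite_set A by apply: card_le_finite Ak _; exact: finite_II.
by rewrite /counting asboolT// lee_fin ler_nat geq_card_fset_set.
Qed.

Lemma besselJ_sqr (R : realType) l (x : R) :
  besselJ l x ^+ 2 = besselN `|l|%N x ^+ 2.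
Proof. by rewrite besselJE exprMn besselJ_sign_sqr mul1r. Qed.

Lemma measurable_besselJ_kernel (R : realType) l :
  measurable_fun setT (fun p : R * R => besselJ l (p.1 * p.2)).
Proof.
under eq_fun do rewrite besselJE.
apply: measurable_funM => //.
apply: (@measurableT_comp _ _ _ _ _ _ (@besselN R `|l|%N)).
  by apply: continuous_measurable_fun; exact: continuous_besselN.
exact: measurable_funM.
Qed.

Lemma continuous_monomial (R : realType) (c : R) n :
  continuous (fun x : R => c * x ^+ n).
Proof. by move=> x; apply: cvgM; [exact: cvg_cst|exact: exprn_continuous]. Qed.

Section bessel_singular_values.
Context (R : realType) (D K : R) (l : int).
Variables (U : nat -> R -> R) (S : nat -> R) (V : nat -> R -> R).
Hypotheses (D0 : 0 < D) (K0 : 0 < K).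
Hypothesis svd : radial_svd D K (fun x k => besselJ l (x * k)) U S V.

(** For x k <= z the truncation error is at most [M]. The constant [M] has Hilbert-Schmidt norm M D
    K / 2 = z exp(2z) / 2^N, and z <= exp z. *)
Lemma besselJ_singular_value_le (i : nat) : 0 < S i ->
  S i <= expR (3 * (D * K)) / 2 ^+ (i.*2 + `|l|).
Proof.
move=> Si0; set N := (i.*2 + `|l|)%N; set z := D * K.
have z0 : 0 < z by rewrite mulr_gt0.
pose a (j : 'I_i) (x : R) := (besselJ_sign l *
  ((-1) ^+ j / (j`! * (j + `|l|)`!)%N%:R) / 2 ^+ (j.*2 + `|l|)) * x ^+ (j.*2 + `|l|).
pose b (j : 'I_i) (k : R) := 1 * k ^+ (j.*2 + `|l|).
pose M := 2 * (expR (2 * z) / 2 ^+ N).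
have M0 : 0 <= M by rewrite mulr_ge0// divr_ge0 ?expR_ge0.
have ab x k : \sum_(j < i) a j x * b j k =
    besselJ_sign l * besselN_trunc `|l|%N i (x * k).
  have := congr1 (fun F => F i) (series_besselJ_coeff `|l|%N (x * k)) => /= <-.
  rewrite /series/= big_mkord mulr_sumr; apply: eq_bigr => j _.
  rewrite /a /b /besselJ_coeff expr_div_n exprMn; ring.
have le1 : S i ^+ 2 <= (M ^+ 2 * D ^+ 2 / 2) * (1 * K ^+ 2 / 2).
  apply: (radial_svd_le (a := a) (b := b) (al := fun x => M ^+ 2 * x)
    (be := fun k => 1 * k) svd) => //.
  - exact: measurable_besselJ_kernel.
  - by move=> j; exact: continuous_monomial.
  - by move=> j; exact: continuous_monomial.
  - by apply: measurable_funM.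
  - by apply: measurable_funM.
  - by move=> x /andP[x0 _]; rewrite mulr_ge0// sqr_ge0.
  - by move=> k /andP[k0 _]; rewrite mul1r.
  - exact: integral_itv_id.
  - exact: integral_itv_id.
  - move=> x k /andP[x0 xD] /andP[k0 kK].
    rewrite ab besselJE -mulrBr exprMn besselJ_sign_sqr !mul1r.
    rewrite -[leLHS]mulrA -[leRHS]mulrA [k * x]mulrC.
    apply: ler_wpM2r; first exact: mulr_ge0.
    rewrite -[leLHS]real_normK ?num_real// lerXn2r ?nnegrE//.
    have xk : 0 <= x * k by rewrite mulr_ge0.
    apply: le_trans (besselN_tail _ _ xk) _.
    rewrite ler_pM2l// ler_pM2r ?invr_gt0 ?exprn_gt0// ler_expR ler_pM2l//.
    by rewrite ler_pM.
have {le1} le2 : S i <= M * z / 2.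
  have Mz : 0 <= M * z / 2 by rewrite divr_ge0 ?mulr_ge0// ltW.
  rewrite -(@ler_pXn2r _ 2) ?nnegrE ?(ltW Si0)//.
  by apply: le_trans le1 _; rewrite /z le_eqVlt; apply/orP; left; apply/eqP; field.
apply: le_trans le2 _.
rewrite (_ : M * z / 2 = z * expR (2 * z) / 2 ^+ N); last first.
  by rewrite /M; have : (2 : R) ^+ N != 0 by []; move=> ?; field.
rewrite ler_pM2r ?invr_gt0 ?exprn_gt0//.
rewrite (_ : 3 * z = z + 2 * z); last by ring.
rewrite expRD ler_pM2r ?expR_gt0//.
by have := expR_ge1Dx z; lra.
Qed.

(* For [eps >= 1] a bound on the rank that grows with [W] is not enough: it has to
   vanish unless [W + ln (1 / eps)] is bounded below by a multiple of [W + 1].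
   The factor 99/100 and the shift 1/100 provide that margin. The bound [pi W]
   that follows from [|J_l| <= 1] would not do: it exceeds [exp W] at [W = 1]. *)
Lemma besselJ_singular_value0_le : 0 < S 0 ->
  S 0 <= expR (99 / 100 * (D * K / (2 * pi)) - 1 / 100).
Proof.
move=> S0; set W := D * K / (2 * pi).
have p0 := pi_gt0 R. have p1 := pi_le_16_5 R.
have W0 : 0 < W by rewrite divr_gt0 ?mulr_gt0.
have zW : D * K <= 32 / 5 * W.
  have -> : D * K = W * (2 * pi) by rewrite /W divfK// gt_eqF// mulr_gt0.
  by rewrite mulrC ler_pM2r//; lra.
have e1 : 98 / 100 <= expR (- (2 / 100)) :> R.
  by have := expR_ge1Dx (- (2 / 100) : R); lra.
have e2 := expR_ge_mul (_ : 0 <= 99 / 100 * W).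
have e3 := expR_ge_mul (_ : 0 <= 198 / 100 * W).
have {e2} e2 := e2 ltac:(lra). have {e3} e3 := e3 ltac:(lra).
have ee : expR (99 / 100 * W - 1 / 100) ^+ 2 =
    expR (198 / 100 * W) * expR (- (2 / 100)).
  by rewrite -expRM_natl -expRD; congr expR; field.
have ee2 : expR (198 / 100 * W) = expR (99 / 100 * W) * expR (99 / 100 * W).
  by rewrite -expRD; congr expR; field.
(* With z <= 32 W / 5, these are the bounds 3 z / 4 for l = 0 and z^2 / 8 for the other orders. *)
have Sle : S 0 ^+ 2 <= 24 / 5 * W \/ S 0 ^+ 2 <= 128 / 25 * W ^+ 2.
  have [l0|l0] := eqVneq l 0.
    left; apply: (@le_trans _ _ ((3 / 4 * D) * (1 * K))); last by lra.
    apply: (radial_svd_le (n := 0) (a := fun=> cst 0) (b := fun=> cst 0)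
      (al := fun=> 3 / 4) (be := fun=> 1) svd) => //.
    - exact: measurable_besselJ_kernel.
    - by move=> *; exact: cst_continuous.
    - by move=> *; exact: cst_continuous.
    - exact: integral_itv_cst (ltW _).
    - exact: integral_itv_cst (ltW _).
    - move=> x k /andP[x0 _] /andP[k0 _].
      rewrite big_ord0 subr0 besselJ_sqr l0 /= mulr1 -mulrA [k * x]mulrC [leLHS]mulrC.
      by apply: besselN0_decay; rewrite mulr_ge0.
  right; apply: (@le_trans _ _ ((1 / 2 * D ^+ 2 / 2) * (1 * K ^+ 2 / 2))); last first.
    have := mulr_gt0 D0 K0.
    by nra.
  apply: (radial_svd_le (n := 0) (a := fun=> cst 0) (b := fun=> cst 0)
      (al := fun x => 1 / 2 * x) (be := fun k => 1 * k) svd) => //.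
  - exact: measurable_besselJ_kernel.
  - by move=> *; exact: cst_continuous.
  - by move=> *; exact: cst_continuous.
  - by apply: measurable_funM.
  - by apply: measurable_funM.
  - by move=> x /andP[x0 _]; lra.
  - by move=> x /andP[x0 _]; lra.
  - exact: integral_itv_id.
  - exact: integral_itv_id.
  - move=> x k /andP[x0 _] /andP[k0 _].
    rewrite big_ord0 subr0 besselJ_sqr (mul1r k) -[leLHS]mulrA -[leRHS]mulrA.
    rewrite [k * x]mulrC; apply: ler_wpM2r; first exact: mulr_ge0.
    have : (0 < `|l|)%N by rewrite absz_gt0.
    by case: `|l|%N => // n _; apply: besselN_sqr_le_half; rewrite mulr_ge0.
rewrite -(@ler_pXn2r _ 2) ?nnegrE ?(ltW S0) ?expR_ge0// ee.
(* The linear case rests on 63/25 * 198/100 * 98/100 > 24/5. The quadratic one rests on (63/25 *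
   99/100)^2 > 6 and 6 * 98/100 > 128/25. *)
case: Sle => /le_trans; apply.
  nra.
rewrite ee2.
have q : (63 / 25 * (99 / 100 * W)) * (63 / 25 * (99 / 100 * W)) <=
    expR (99 / 100 * W) * expR (99 / 100 * W) by apply: ler_pM => //; lra.
have q2 : 6 * (W * W) * (98 / 100) <=
    expR (99 / 100 * W) * expR (99 / 100 * W) * expR (- (2 / 100)).
  by apply: ler_pM => //; nra.
by rewrite expr2; nra.
Qed.

End bessel_singular_values.

(** * Counting *)

(** A pair (l, i) is coded in base M+1 with quotient l + M and remainder i. As l + M >= 0, the
    absolute value only converts it to a natural number. *)
Lemma int_nat_code_inj (M : nat) (p q : int * nat) :
  (`|p.1| <= M)%N -> (p.2 <= M)%N -> (`|q.1| <= M)%N -> (q.2 <= M)%N ->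
  (`|(p.1 + M%:Z)%R| * M.+1 + p.2 = `|(q.1 + M%:Z)%R| * M.+1 + q.2)%N -> p = q.
Proof.
case: p q => [l i] [l' i'] /= lM iM lM' iM' e.
have := congr1 (divn^~ M.+1) e; have := congr1 (modn^~ M.+1) e.
rewrite !modnMDl !divnMDl// !modn_small ?ltnS// !divn_small ?ltnS// !addn0.
by move=> -> el; congr (_, _); lia.
Qed.

Lemma int_nat_code_lt (M : nat) (p : int * nat) :
  (`|p.1| <= M)%N -> (p.2 <= M)%N ->
  (`|(p.1 + M%:Z)%R| * M.+1 + p.2 < M.*2.+1 * M.+1)%N.
Proof.
case: p => [l i] /= lM iM.
have h : (`|(l + M%:Z)%R| <= M.*2)%N by lia.
by rewrite mulSn addnC -addSn leq_add// leq_mul2r h orbT.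
Qed.

Unset Implicit Arguments.

Theorem theorem1 (R : realType) :
  exists C : R, 0 < C /\
    forall (D K eps : R) (sigma : nat -> R),
      0 < D -> 0 < K -> 0 < eps ->
      translation_singular_values D K sigma ->
      let W := D * K / (2 * pi) in
      (eps_rank sigma eps <= (C * (W + ln (1 / eps)) ^+ 2)%:E)%E.
Proof.
(* The count is at most (2M+1)(M+1) with M <= 37 X, X >= 1 and X = 100 Y, hence at most 75 X * 38
   X. *)
exists (75 * 38 * 100 ^+ 2); split; first by rewrite !mulr_gt0// exprn_gt0.
move=> D K eps sigma D0 K0 eps0 [U [S [V [e [svd be sE _]]]]].
cbv zeta; set W := D * K / (2 * pi).
have p0 := pi_gt0 R. have p1 := pi_le_16_5 R.
have W0 : 0 < W by rewrite divr_gt0 ?mulr_gt0.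
have zW : D * K <= 32 / 5 * W.
  have -> : D * K = W * (2 * pi) by rewrite /W divfK// gt_eqF// mulr_gt0.
  by rewrite mulrC ler_pM2r//; lra.
rewrite div1r lnV ?posrE//; set Y := W - ln eps.
pose X := 100 * Y.
(* Here ln eps < 99 W / 100 - 1/100, so Y = W - ln eps exceeds (W + 1) / 100. *)
have Y_lb l i : eps < S l i -> W + 1 <= X.
  move=> eS; have [_ _ dS _ _] := svd l.
  have eS0 : eps < S l 0%N by apply: (lt_le_trans eS); exact: dS.
  have := besselJ_singular_value0_le D0 K0 (svd l) (lt_trans eps0 eS0).
  move=> /(lt_le_trans eS0); rewrite -{1}(lnK (_ : eps \is Num.pos)) ?posrE//.
  by rewrite ltr_expR -/W /X /Y; lra.
(* Taking logarithms, N/2 < 3 D K - ln eps <= 96 W / 5 + Y - W. Both W <= X and Y = X / 100 then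
   bound N by 37 X. *)
have N_ub l i : eps < S l i -> (i.*2 + `|l|)%N%:R <= 37 * X.
  move=> eS; have YW := Y_lb _ _ eS; set N := (i.*2 + `|l|)%N.
  have := besselJ_singular_value_le D0 K0 (svd l) (lt_trans eps0 eS).
  rewrite -/N => /(lt_le_trans eS) h.
  have e2 : expR (N%:R / 2) <= 2 ^+ N :> R.
    rewrite mulrC expRM_natr lerXn2r ?nnegrE ?expR_ge0//.
    (* exp(1/2) <= 2 follows from exp(-1/2) >= 1 - 1/2. *)
    have := expR_ge1Dx (- 2^-1 : R); rewrite expRN.
    have := expR_gt0 (2^-1 : R) => x0 x1.
    rewrite -[leLHS]invrK -[leRHS]invrK lef_pV2 ?posrE ?invr_gt0//.
    by apply: le_trans x1; lra.
  have : eps < expR (3 * (D * K) - N%:R / 2).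
    apply: (lt_le_trans h); rewrite expRD expRN ler_pM2l ?expR_gt0//.
    by rewrite lef_pV2 ?posrE ?expR_gt0 ?exprn_gt0.
  rewrite -{1}(lnK (_ : eps \is Num.pos)) ?posrE// ltr_expR.
  by rewrite /X /Y in YW *; lra.
(* The lower bound on X needs a singular value above eps; if there is none, the rank is 0 and a
   square bounds it. *)
have [[z0 z0S]|noS] := pselect (exists z, eps < sigma z); last first.
  have rank0 : (eps_rank sigma eps <= (0%N%:R : R)%:E)%E.
    apply: (@counting_le R _ _ id) => // z /= zS.
    by exfalso; apply: noS; exists z.
  apply: (le_trans rank0); rewrite lee_fin.
  by rewrite mulr_ge0 ?sqr_ge0// !mulr_ge0// exprn_ge0.
have Y0 : W + 1 <= X by move: z0S; rewrite sE => /Y_lb.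
pose M := Num.truncn (37 * X).
have MY : M%:R <= 37 * X by rewrite truncn_le//; lra.
have NM z : eps < sigma z -> ((e z).2.*2 + `|(e z).1| <= M)%N.
  by rewrite sE => /N_ub; rewrite truncn_ge_nat//; lra.
(* 2 i + |l| <= M bounds both i and |l| by M, and [e] is injective, so distinct indices have
   distinct codes. *)
have cM : (eps_rank sigma eps <= ((M.*2.+1 * M.+1)%N%:R : R)%:E)%E.
  apply: (@counting_le _ _ _ (fun z => `|((e z).1 + M%:Z)%R| * M.+1 + (e z).2)%N).
    move=> z z' /set_mem/= /NM zM /set_mem/= /NM zM' h.
    apply: (bij_inj be); apply: (@int_nat_code_inj M) => //; lia.
  by move=> z /= /NM zM; apply: int_nat_code_lt; lia.
apply: (le_trans cM); rewrite lee_fin natrM -addn1 -(addn1 M) !natrD -muln2 natrM.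
rewrite (_ : 75 * 38 * 100 ^+ 2 * Y ^+ 2 = (75 * X) * (38 * X)); last first.
  by rewrite /X; ring.
by apply: ler_pM => //; lra.
Qed.
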